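(* Let $d\ge 1$, $m\ge 0$, let $H_D=-i\alpha\cdot\nabla+m\beta$ be the free Dirac operator on $\mathbb{R}^d$, let $V$ be a matrix-valued potential and $H=H_D+V$. Let $H_0=-\Delta$, let $L=\{H_D,iG\}$ with $iG=\frac d2+x\cdot\nabla$, and, for a given function $\phi:\mathbb{R}^d\to\mathbb{R}$, let $L_\phi=\{H_D,iG_\phi\}$ with $iG_\phi=-\frac14[H_0,\phi]$. Then $$[H,L]=2H_0+[V,L],$$ $$[H,L_\phi]=-\tfrac14\big[H_0,[H_0,\phi]\big]+[V,L_\phi],$$ the identities being understood on functions on which every term involved is well defined.
   Context: Let $N=2^{\lfloor (d+1)/2\rfloor}$ and let $\alpha_1,\dots,\alpha_d,\beta$ be Hermitian $N\times N$ matrices with $\alpha_j\alpha_k+\alpha_k\alpha_j=2\delta_{jk}I$, $\alpha_j\beta+\beta\alpha_j=0$, $\beta^2=I$. Operators act on $\mathbb{C}^N$-valued functions on $\mathbb{R}^d$; $\alpha\cdot\nabla=\sum_j\alpha_j\partial_j$; $H_0=-\Delta$ acts componentwise. $V:\mathbb{R}^d\to\mathbb{C}^{N\times N}$ and $\phi$ act by multiplication. $[A,B]=AB-BA$ and $\{A,B\}=AB+BA$. The operator $G=\frac12(p\cdot x+x\cdot p)$, $p=-i\nabla$, is the generator of dilations, so that $iG=\frac d2+x\cdot\nabla=-\frac14[H_0,|x|^2]$. *)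

(* Defs.v *)
From HB Require Import structures.
From mathcomp Require Import all_boot all_order all_algebra.
From mathcomp Require Import all_classical all_reals all_analysis.
From mathcomp Require Export complex.

Set Implicit Arguments.
Unset Strict Implicit.
Unset Printing Implicit Defensive.

Import Order.TTheory GRing.Theory Num.Theory.
Import numFieldNormedType.Exports.

Local Open Scope classical_set_scope.
Local Open Scope ring_scope.
Local Open Scope complex_scope.

Definition spinor (R : realType) (d N : nat) : Type :=
  'rV[R]_d -> 'cV[R[i]]_N.

(* An operator in the sense of unbounded operators: a domain together with an
   action; the value of [act] outside [dom] carries no meaning.  Sums and
   products have the usual maximal domains. *)
Record operator (R : realType) (d N : nat) := Operator {
  dom : set (spinor R d N);
  act :> spinor R d N -> spinor R d N }.

Section Operators.
Context {R : realType} {d N : nat}.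
Implicit Types (A B : operator R d N) (c : R[i]) (f : spinor R d N).

Definition op_add A B : operator R d N :=
  Operator (dom A `&` dom B) (fun f x => A f x + B f x).

Definition op_sub A B : operator R d N :=
  Operator (dom A `&` dom B) (fun f x => A f x - B f x).

Definition op_scale c A : operator R d N :=
  Operator (dom A) (fun f x => c *: A f x).

Definition op_mul A B : operator R d N :=
  Operator [set f | dom B f /\ dom A (B f)] (fun f => A (B f)).

Definition commutator A B := op_sub (op_mul A B) (op_mul B A).

Definition anticommutator A B := op_add (op_mul A B) (op_mul B A).

(* An identity between operators, understood on the functions on which every
   term of both sides is well defined. *)
Definition op_identity A B : Prop :=
  forall f, dom A f -> dom B f -> forall x, A f x = B f x.

Definition op_matrix (V : 'rV[R]_d -> 'M[R[i]]_N) : operator R d N :=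
  Operator setT (fun f x => V x *m f x).

Definition op_scalar (phi : 'rV[R]_d -> R) : operator R d N :=
  Operator setT (fun f x => (phi x)%:C *: f x).

Definition basis_vector (j : 'I_d) : 'rV[R]_d := delta_mx 0 j.

(* [R[i]] carries no normed-module structure over [R] in the library, so real
   partial derivatives are taken on real and imaginary parts. *)
Definition re_part f (k : 'I_N) (x : 'rV[R]_d) : R := complex.Re (f x k 0).
Definition im_part f (k : 'I_N) (x : 'rV[R]_d) : R := complex.Im (f x k 0).

Definition partial (j : 'I_d) f : spinor R d N := fun x =>
  \col_k ('D_(basis_vector j) (re_part f k) x
          +i* 'D_(basis_vector j) (im_part f k) x).

Definition continuously_derivable (u : 'rV[R]_d -> R) : Prop :=
  forall j, (forall x, derivable u x (basis_vector j)) /\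
            continuous (fun x => 'D_(basis_vector j) u x).

Definition C1 : set (spinor R d N) := [set f | forall k,
  continuously_derivable (re_part f k) /\ continuously_derivable (im_part f k)].

Definition C2 : set (spinor R d N) :=
  [set f | C1 f /\ forall j, C1 (partial j f)].

Definition free_schrodinger : operator R d N :=
  Operator C2 (fun f x => - \sum_j partial j (partial j f) x).

Definition free_dirac (alpha : 'I_d -> 'M[R[i]]_N) (beta : 'M[R[i]]_N) (m : R) :
    operator R d N :=
  Operator C1 (fun f x =>
    - 'i%C *: (\sum_j alpha j *m partial j f x) + m%:C *: (beta *m f x)).

(* [iG = d/2 + x . nabla] *)
Definition dilation : operator R d N :=
  Operator C1 (fun f x =>
    (d%:R / 2) *: f x + \sum_j (x 0 j)%:C *: partial j f x).

(* [iG_phi = - 1/4 [H_0, phi]] *)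
Definition dilation_weighted (phi : 'rV[R]_d -> R) : operator R d N :=
  op_scale (- 4^-1) (commutator free_schrodinger (op_scalar phi)).

End Operators.

(* Main.v *)
(* Since [V f] and [H f] both lie in the domain of [L], so does [H_D f], and
   the claim reduces to [H_D, {H_D, K}] = [H_D^2, K] for K = iG or iG_phi.  For
   K = iG_phi the hypotheses make [K f] of class C^2, where H_D^2 = H_0 + m^2.
   For K = iG the function [K f] need not be C^2.  Instead the identity
   [H_D, iG] h = -i (alpha . nabla) h is applied to h = f and to h = H_D f; it
   only needs h, iG h and H_D h to be C^1.  Second derivatives of such an h may
   fail to exist, but s |-> d_j h (e^s x) is differentiable, by Peano's form of
   the theorem on mixed derivatives applied to (s, t) |-> h (e^s (x + t e_j)). *)

Require Import Defs.
From HB Require Import structures.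
From mathcomp Require Import all_boot all_order all_algebra.
From mathcomp Require Import all_classical all_reals all_analysis.
From mathcomp Require Import ring lra.

Set Implicit Arguments.
Unset Strict Implicit.
Unset Printing Implicit Defensive.

Import Order.TTheory GRing.Theory Num.Theory.
Import numFieldNormedType.Exports.

Local Open Scope ring_scope.

(** * Derivatives along lines, the mean value theorem and mixed derivatives for real functions *)

Section RealCalculus.
Local Open Scope classical_set_scope.
Context {R : realType}.

Lemma cvg_is_derive (V : normedModType R) (f : V -> R) (x v : V) (l : R) :
  (h^-1 *: (f (h *: v + x) - f x) @[h --> 0^'] --> l) -> is_derive x v f l.
Proof.
move=> fl; have cf : cvg (h^-1 *: (f (h *: v + x) - f x) @[h --> 0^']).
  by apply/cvg_ex; exists l.
by split=> //; apply/cvg_lim.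
Qed.

Lemma is_derive_cvg (V : normedModType R) (f : V -> R) (x v : V) (l : R) :
  is_derive x v f l -> h^-1 *: (f (h *: v + x) - f x) @[h --> 0^'] --> l.
Proof. by case=> df <-; exact: df. Qed.

(** The two difference quotients are the same function of the increment, so existence and value of
    the derivative transfer both ways. One-variable theorems reach directional derivatives through
    this equivalence. *)
Lemma is_derive_lineP (V : normedModType R) (f : V -> R) (x v : V) (t l : R) :
  is_derive (t *: v + x) v f l <-> is_derive t (1 : R) (fun h => f (h *: v + x)) l.
Proof.
have eqf : (fun h : R => h^-1 *: (f (h *: v + (t *: v + x)) - f (t *: v + x))) =
  (fun h : R => h^-1 *: (f ((h *: 1 + t) *: v + x) - f (t *: v + x))).
  by apply/funext => h; rewrite addrA -scalerDl /GRing.scale /= mulr1.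
split=> -[df <-]; apply: cvg_is_derive.
  by move: df; rewrite /derivable /derive /= eqf.
by move: df; rewrite /derivable /derive /= eqf.
Qed.

(** The increment may have either sign, and the intermediate point is recorded as an offset bounded
    by [|h|]; limits at 0 use it in this form. *)
Lemma mean_value (f df : R -> R) (a h : R) :
  (forall x, is_derive x (1 : R) f (df x)) ->
  exists2 c, `|c| <= `|h| & f (a + h) - f a = h * df (a + c).
Proof.
move=> fd.
have fc : continuous f.
  by move=> x; apply/differentiable_continuous/derivable1_diffP; have [] := fd x.
have [h0|h0] := leP 0 h.
  have ah : a <= a + h by rewrite lerDl.
  have [|c] := MVT_segment ah (fun x _ => fd x).
    exact: continuous_subspaceT.
  rewrite in_itv /= => /andP[ac ch] eq; exists (c - a).
    by rewrite !ger0_norm ?subr_ge0// lerBlDl.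
  by rewrite eq [a + (c - a)]addrC subrK; ring.
have ah : a + h <= a by rewrite gerDl ltW.
have [|c] := MVT_segment ah (fun x _ => fd x).
  exact: continuous_subspaceT.
rewrite in_itv /= => /andP[ac ch] eq; exists (c - a).
  rewrite ler0_norm ?subr_le0// ltr0_norm//; lra.
by rewrite -opprB eq [a + (c - a)]addrC subrK; ring.
Qed.

(* Peano's theorem: the other mixed derivative is not assumed to exist. *)
Lemma mixed_derivative (w wr wrt : R -> R -> R) (wt : R -> R) (r0 t0 : R) :
  (forall r t, is_derive r (1 : R) (w ^~ t) (wr r t)) ->
  (forall r t, is_derive t (1 : R) (wr r) (wrt r t)) ->
  (forall r, is_derive t0 (1 : R) (w r) (wt r)) ->
  {for (r0, t0), continuous (fun p => wrt p.1 p.2)} ->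
  is_derive r0 (1 : R) wt (wrt r0 t0).
Proof.
move=> dr drt dt cwrt; apply: cvg_is_derive.
apply/cvgrPdist_le => e e0.
have /cvgrPdist_le /(_ _ e0) := cwrt.
move=> -[[/= A B] [[a /= a0 aA] [b /= b0 bB]] AB].
(* Half-width of a square around [(r0, t0)] on which [wrt] stays within [e] of its central value. *)
pose dlt := Num.min a b.
have dlt0 : 0 < dlt by rewrite lt_min a0 b0.
have close x y : `|x| < dlt -> `|y| < dlt ->
    `|wrt r0 t0 - wrt (r0 + x) (t0 + y)| <= e.
  rewrite !lt_min => /andP[xa _] /andP[_ yb].
  apply: (AB (r0 + x, t0 + y)); split => /=; [apply: aA|apply: bB];
    by rewrite /= opprD addrA subrr add0r normrN.
exists dlt => //= h; rewrite /ball_ /= sub0r normrN => hd hn0.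
rewrite [h *: 1]mulr1.
(* [q k] is the second-order difference quotient with increments [h] in [r] and [k] in [t]. For
   fixed [h], letting [k] tend to 0 gives the difference quotient of [wt]. *)
pose q (k : R) := h^-1 * (k^-1 * (w (h + r0) (k + t0) - w (h + r0) t0)
                 - k^-1 * (w r0 (k + t0) - w r0 t0)).
have qcv : q k @[k --> 0^'] --> h^-1 * (wt (h + r0) - wt r0).
  have lim r : k^-1 * (w r (k + t0) - w r t0) @[k --> 0^'] --> wt r.
    have [+ <-] := dt r; rewrite /derivable /derive /=.
    under eq_fun do rewrite {1}/GRing.scale /= {1}/GRing.scale /= mulr1.
    done.
  by apply: cvgM; [exact: cvg_cst|apply: cvgB].
have ncv : `|wrt r0 t0 - q k| @[k --> 0^'] -->
    `|wrt r0 t0 - h^-1 * (wt (h + r0) - wt r0)|.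
  by apply: cvg_norm; apply: cvgB => //; exact: cvg_cst.
have nle : \forall k \near 0^', `|wrt r0 t0 - q k| <= e.
  exists dlt => //= k; rewrite /ball_ /= sub0r normrN => kd kn0.
  have dr' x : is_derive x (1 : R) (fun r => w r (t0 + k) - w r t0) (wr x (t0 + k) - wr x t0).
    exact: is_deriveB.
  (* The mean value theorem is used first in [r], on the difference of two slices, then in [t], on
     [wr]. Thus [q k] equals [wrt] at a point of the square. *)
  have [c ch eqc] := mean_value r0 h dr'.
  have [c' ck eqk] := mean_value t0 k (drt (r0 + c)).
  suff -> : q k = wrt (r0 + c) (t0 + c').
    by apply: close; [apply: le_lt_trans ch _|apply: le_lt_trans ck _].
  have -> : q k = (k * h)^-1 * (w (r0 + h) (t0 + k) - w (r0 + h) t0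
                 - (w r0 (t0 + k) - w r0 t0)).
    by rewrite /q (addrC h) (addrC k) invfM; ring.
  rewrite eqc eqk.
  by field; rewrite hn0 kn0.
(* The bound on [q k] is uniform in small [k], so it survives the limit in [k] at fixed [h]. *)
rewrite -(cvg_lim _ ncv)//; apply: limr_le; last exact: nle.
by apply/cvg_ex; eexists; exact: ncv.
Qed.

Lemma line_continuous (V : normedModType R) (a b x : V) :
  continuous (fun p : R * R => p.1 *: a + (p.2 *: b + x)).
Proof.
move=> p.
have c1 : (fun p : R * R => p.1) @ p --> p.1 by exact: cvg_fst.
have c2 : (fun p : R * R => p.2) @ p --> p.2 by exact: cvg_snd.
have z1 := cvgZr_tmp c1 (a:=a).
have z2 := cvgZr_tmp c2 (a:=b).
apply: cvgD; first exact: z1.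
apply: cvgD; first exact: z2.
exact: cvg_cst.
Qed.

(** A step along [a + b] is split into a step along [b] from [x] and a step along [a] from
    [h *: b + x]. The mean value theorem turns the quotient of the latter into [fa] at a point
    tending to [x], where continuity of [fa] gives the limit. *)
Lemma derivative_add (V : normedModType R) (f fa fb : V -> R) (a b : V) :
  (forall x, is_derive x a f (fa x)) -> (forall x, is_derive x b f (fb x)) ->
  continuous fa -> forall x, is_derive x (a + b) f (fa x + fb x).
Proof.
move=> da db ca x; apply: cvg_is_derive.
have lb : h^-1 *: (f (h *: b + x) - f x) @[h --> 0^'] --> fb x.
  exact: is_derive_cvg.
suff la : h^-1 *: (f (h *: a + (h *: b + x)) - f (h *: b + x)) @[h --> 0^'] --> fa x.
  have -> : (fun h : R => h^-1 *: (f (h *: (a + b) + x) - f x)) =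
    (fun h : R => h^-1 *: (f (h *: a + (h *: b + x)) - f (h *: b + x))
       + h^-1 *: (f (h *: b + x) - f x)).
    by apply/funext => h; rewrite -[RHS]scalerDr subrKA (scalerDr h) addrA.
  exact: cvgD.
apply/cvgrPdist_le => e e0.
have /cvgrPdist_le /(_ _ e0) := ca x.
have line : (fun p : R * R => p.1 *: a + (p.2 *: b + x)) @ ((0 : R), (0 : R)) --> x.
  have := @line_continuous V a b x ((0 : R), (0 : R)).
  rewrite /continuous_at [X in _ --> X](_ : _ = x)//=.
  by rewrite !scale0r !add0r.
move=> /line [[/= A B] [[s /= s0 sA] [t /= t0 tB]] AB].
exists (Num.min s t) => [|/= h]; first by rewrite /= lt_min s0 t0.
rewrite /ball_ /= sub0r normrN lt_min => /andP[hs ht] hn0.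
have dh r : is_derive r (1 : R) (fun k => f (k *: a + (h *: b + x))) (fa (r *: a + (h *: b + x))).
  exact: (iffLR (is_derive_lineP f _ a r _) (da _)).
have [c ch] := mean_value 0 h dh.
rewrite !add0r scale0r add0r => ->.
rewrite /GRing.scale /= mulrA mulVf// mul1r.
apply: (AB (c, h)); split => /=; [apply: sA|apply: tB];
  rewrite /= sub0r normrN //; exact: le_lt_trans hs.
Qed.
End RealCalculus.

(** * Functions with continuous partial derivatives: directions, symmetry, dilations *)

Section PartialDerivatives.
Local Open Scope classical_set_scope.
Context {R : realType}.

Lemma is_derive_unique (V : normedModType R) (f : V -> R) (x v : V) (a b : R) :
  is_derive x v f a -> is_derive x v f b -> a = b.
Proof. by move=> [_ <-] [_ <-]. Qed.

(** Chain rule on the line through [x], with inner function [h |-> c * h]; this treats [c = 0]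
    together with the other values. *)
Lemma is_derive_scale (V : normedModType R) (f : V -> R) (c : R) (x v : V) (l : R) :
  is_derive x v f l -> is_derive x (c *: v) f (c * l).
Proof.
move=> fl; suff cl : is_derive (0 : R) (1 : R) (fun h => f (h *: (c *: v) + x)) (c * l).
  have := iffRL (is_derive_lineP f x (c *: v) 0 (c * l)) cl.
  by rewrite scale0r add0r.
have fl' : is_derive (c * 0) (1 : R) (fun h => f (h *: v + x)) l.
  apply: (iffLR (is_derive_lineP f x v (c * 0) l)).
  by rewrite mulr0 scale0r add0r.
have cd : is_derive (0 : R) (1 : R) (fun h : R => c * h) c.
  by apply: is_derive_eq; rewrite ?scaler0 ?addr0 /GRing.scale /= ?mulr1.
have := is_derive1_comp fl' cd.
rewrite mulrC (_ : _ \o _ = (fun h => f (h *: (c *: v) + x)))//.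
by apply/funext => h /=; rewrite scalerA mulrC.
Qed.

Lemma continuous_mull (V : normedModType R) (c : R) (f : V -> R) :
  continuous f -> continuous (fun y => c * f y).
Proof. by move=> cf y; apply: cvgMl_tmp; exact: cf. Qed.

Context {d : nat}.
Implicit Types (u : 'rV[R]_d -> R) (x y v : 'rV[R]_d).

Lemma continuously_derivable_direction u v x : continuously_derivable u ->
  is_derive x v u (\sum_j v 0 j * 'D_(basis_vector j) u x).
Proof.
move=> cu.
have cj j y : is_derive y (v 0 j *: basis_vector j) u (v 0 j * 'D_(basis_vector j) u y).
  by apply: is_derive_scale; apply: derivableP; apply: (cu j).1.
rewrite [X in is_derive _ X](row_sum_delta v).
elim: (index_enum _) x => [|j s IHs] x; first by rewrite !big_nil; exact: is_derive0.
rewrite !big_cons.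
(* [derivative_add] asks for continuity of the derivative along its first direction, so the single
   axis takes that place and the remaining sum the second. *)
by apply: (derivative_add (cj j) IHs); apply: continuous_mull; exact: (cu j).2.
Qed.

(** The function [r |-> 'D_j u (g r 0)] is differentiated at 0 twice: directly along the [k] axis
    ([E1]), and by [mixed_derivative] ([E2]). Uniqueness of the derivative equates the results. *)
Lemma partial_comm u j k x : continuously_derivable u ->
  (forall i, continuously_derivable ('D_(basis_vector i) u)) ->
  'D_(basis_vector j) ('D_(basis_vector k) u) x =
  'D_(basis_vector k) ('D_(basis_vector j) u) x.
Proof.
move=> cu cdu.
pose g (r t : R) := r *: basis_vector k + (t *: basis_vector j + x).
have du i y : is_derive y (basis_vector i) u ('D_(basis_vector i) u y).
  by apply: derivableP; apply: (cu i).1.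
have ddu i l y : is_derive y (basis_vector i) ('D_(basis_vector l) u)
    ('D_(basis_vector i) ('D_(basis_vector l) u) y).
  by apply: derivableP; apply: (cdu l i).1.
have line (f : 'rV[R]_d -> R) r t l : is_derive (g r t) (basis_vector j) f l ->
    is_derive t (1 : R) (fun t => f (g r t)) l.
  rewrite (_ : (fun t => f (g r t)) =
    (fun t => f (t *: basis_vector j + (r *: basis_vector k + x)))); last first.
    by apply/funext => t'; rewrite /g addrCA.
  by rewrite /g addrCA => /(iffLR (is_derive_lineP f _ _ _ _)).
have E1 : is_derive (0 : R) (1 : R) (fun r => 'D_(basis_vector j) u (g r 0))
    ('D_(basis_vector k) ('D_(basis_vector j) u) x).
  apply: (iffLR (is_derive_lineP ('D_(basis_vector j) u) (0 *: basis_vector j + x)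
    (basis_vector k) 0 _)).
  by rewrite !scale0r !add0r.
have E2 : is_derive (0 : R) (1 : R) (fun r => 'D_(basis_vector j) u (g r 0))
    ('D_(basis_vector j) ('D_(basis_vector k) u) x).
  have -> : 'D_(basis_vector j) ('D_(basis_vector k) u) x =
      'D_(basis_vector j) ('D_(basis_vector k) u) (g 0 0).
    by rewrite /g !scale0r !add0r.
  have H1 r t : is_derive r (1 : R) (fun r => u (g r t)) ('D_(basis_vector k) u (g r t)).
    exact: (iffLR (is_derive_lineP u (t *: basis_vector j + x) (basis_vector k) r _)
      (du k (g r t))).
  have H2 r t : is_derive t (1 : R) (fun t => 'D_(basis_vector k) u (g r t))
      ('D_(basis_vector j) ('D_(basis_vector k) u) (g r t)).
    exact: (line _ _ _ _ (ddu j k (g r t))).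
  have H3 r : is_derive (0 : R) (1 : R) (fun t => u (g r t)) ('D_(basis_vector j) u (g r 0)).
    exact: (line _ _ _ _ (du j (g r 0))).
  apply: (mixed_derivative H1 H2 H3).
  apply: (@continuous_comp _ _ _ (fun p : R * R => g p.1 p.2)
    ('D_(basis_vector j) ('D_(basis_vector k) u))).
    exact: line_continuous.
  exact: (cdu k j).2.
exact: is_derive_unique E2 E1.
Qed.

Definition euler u x : R := \sum_j x 0 j * 'D_(basis_vector j) u x.

(** The orbit of [x] under dilations stays on the ray from the origin, so this is the chain rule for
    the direction [x] composed with [expR]. The outer factor [e^s] is absorbed by the coordinates of
    [e^s x] in [euler]. *)
Lemma derive_dilation u x (s : R) : continuously_derivable u ->
  is_derive s (1 : R) (fun s => u (expR s *: x)) (euler u (expR s *: x)).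
Proof.
move=> cu.
have := continuously_derivable_direction x (expR s *: x + 0) cu.
move=> /(iffLR (is_derive_lineP u 0 x (expR s) _)) E.
have := is_derive1_comp E (is_derive_expR s).
rewrite (_ : _ \o _ = (fun s => u (expR s *: x))); last first.
  by apply/funext => h /=; rewrite addr0.
rewrite (_ : _ * expR s = euler u (expR s *: x))//.
rewrite mulrC mulr_sumr addr0; apply: eq_bigr => j _.
by rewrite mxE mulrA.
Qed.

(* No second derivatives of [u] are assumed: [mixed_derivative] is applied to
   [(s, t) |-> u (e^s (t e_j + x))], whose [s]-derivative is [euler u]. *)
Lemma derive_partial_dilation u j x :
  continuously_derivable u -> continuously_derivable (euler u) ->
  is_derive (0 : R) (1 : R) (fun s => 'D_(basis_vector j) u (expR s *: x))
    ('D_(basis_vector j) (euler u) x - 'D_(basis_vector j) u x).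
Proof.
move=> cu ceu.
pose g (s t : R) := expR s *: (t *: basis_vector j + x).
(* Varying [t] moves the point [g s t] along [e^s e_j], whence the factor [e^s]. *)
have line (f : 'rV[R]_d -> R) s t : continuously_derivable f ->
    is_derive t (1 : R) (fun t => f (g s t)) (expR s * 'D_(basis_vector j) f (g s t)).
  move=> cf.
  rewrite (_ : (fun t => f (g s t)) =
    (fun t => f (t *: (expR s *: basis_vector j) + expR s *: x))); last first.
    by apply/funext => t'; rewrite /g scalerDr !scalerA mulrC.
  apply: (iffLR (is_derive_lineP f (expR s *: x) (expR s *: basis_vector j) t _)).
  apply: is_derive_scale.
  rewrite /g scalerDr !scalerA mulrC.
  by apply: derivableP; apply: (cf j).1.
have : is_derive (0 : R) (1 : R) (fun s => expR s * 'D_(basis_vector j) u (g s 0))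
    (expR 0 * 'D_(basis_vector j) (euler u) (g 0 0)).
  have H1 s t : is_derive s (1 : R) (fun s => u (g s t)) (euler u (g s t)).
    exact: derive_dilation.
  have H2 s t : is_derive t (1 : R) (fun t => euler u (g s t))
      (expR s * 'D_(basis_vector j) (euler u) (g s t)).
    exact: line.
  have H3 s : is_derive (0 : R) (1 : R) (fun t => u (g s t))
      (expR s * 'D_(basis_vector j) u (g s 0)).
    exact: line.
  apply: (mixed_derivative H1 H2 H3).
  have c1 : continuous (fun p : R * R => expR p.1).
    move=> p; apply: (@continuous_comp _ _ _ (fun p : R * R => p.1) expR).
      exact: cvg_fst.
    exact: continuous_expR.
  have c0 : continuous (fun p : R * R => p.2 *: basis_vector j + x).
    move=> p; have := @line_continuous R _ 0 (basis_vector j) x p.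
    rewrite /continuous_at scaler0 add0r.
    by under eq_fun do rewrite scaler0 add0r.
  have c2 : continuous (fun p : R * R => g p.1 p.2).
    move=> p; apply: (@continuous_comp _ _ _ (fun p : R * R =>
      (expR p.1, p.2 *: basis_vector j + x)) (fun z => z.1 *: z.2)).
      exact: (cvg_pair (c1 p) (c0 p)).
    exact: scale_continuous.
  have c3 : continuous (fun p : R * R => 'D_(basis_vector j) (euler u) (g p.1 p.2)).
    move=> p; apply: (@continuous_comp _ _ _ (fun p : R * R => g p.1 p.2)
      ('D_(basis_vector j) (euler u))).
      exact: c2.
    exact: (ceu j).2.
  exact: (cvgM (c1 _) (c3 _)).
(* The mixed derivative concerns [e^s] times the wanted function. Multiplying by [e^(-s)] removes
   the factor, and the product rule then produces the term [- 'D_j u]. *)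
have : is_derive (0 : R) (1 : R) (fun s : R => expR (- s)) (- 1).
  have := is_derive1_comp (is_derive_expR (- 0)) (is_deriveNid (0 : R) (1 : R)).
  by rewrite oppr0 expR0 [1 * -1]mulrN1.
move=> E1 E2; have := is_deriveM E1 E2.
rewrite (_ : _ * _ = (fun s => 'D_(basis_vector j) u (expR s *: x))); last first.
  apply/funext => s; rewrite /= fctE mulrA -expRD addrC subrr expR0 mul1r.
  by rewrite /g scale0r add0r.
suff -> : 'D_(basis_vector j) (euler u) x - 'D_(basis_vector j) u x =
    expR (- 0) *: (expR 0 * 'D_(basis_vector j) (euler u) (g 0 0)) +
    (expR 0 * 'D_(basis_vector j) u (g 0 0)) *: -1 by [].
rewrite /g oppr0 expR0 !scale1r scale0r add0r !mul1r.
by congr (_ + _); rewrite [RHS]mulrN1.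
Qed.

Lemma continuously_derivableD u w : continuously_derivable u ->
  continuously_derivable w -> continuously_derivable (fun x => u x + w x).
Proof.
move=> cu cv j; have [du Du] := cu j; have [dv Dv] := cv j.
split=> [x|]; first exact: derivableD.
rewrite (_ : (fun x => 'D_(basis_vector j) (fun x => u x + w x) x) =
  (fun x => 'D_(basis_vector j) u x + 'D_(basis_vector j) w x)).
  by move=> x; exact: (cvgD (Du x) (Dv x)).
by apply/funext => x; exact: deriveD.
Qed.

Lemma continuously_derivableZ (c : R) u : continuously_derivable u ->
  continuously_derivable (fun x => c * u x).
Proof.
move=> cu j; have [du Du] := cu j.
split=> [x|]; first exact: derivableZ.
rewrite (_ : (fun x => 'D_(basis_vector j) (fun x => c * u x) x) =
  (fun x => c * 'D_(basis_vector j) u x)).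
  exact: continuous_mull.
by apply/funext => x; exact: deriveZ.
Qed.

Lemma continuously_derivable_sum (I : Type) (s : seq I) (u : I -> 'rV[R]_d -> R) :
  (forall i, continuously_derivable (u i)) ->
  continuously_derivable (fun x => \sum_(i <- s) u i x).
Proof.
move=> cu; elim: s => [|i s IHs].
  rewrite (_ : (fun x => \sum_(i <- [::]) u i x) = cst (0 : R)); last first.
    by apply/funext => x; rewrite big_nil.
  move=> j; split=> [x|]; first exact: derivable_cst.
  rewrite (_ : (fun x => 'D_(basis_vector j) (cst (0 : R)) x) = cst (0 : R)).
    exact: cst_continuous.
  by apply/funext => x; exact: derive_cst.
rewrite (_ : (fun x => \sum_(i <- i :: s) u i x) = (fun x => u i x + \sum_(i <- s) u i x)).
  exact: continuously_derivableD.
by apply/funext => x; rewrite big_cons.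
Qed.
End PartialDerivatives.

(** * Calculus of spinors, by differentiation along curves *)

Section SpinorCalculus.
Local Open Scope complex_scope.
Context {R : realType} {d N : nat}.
Local Notation C := R[i].
Local Notation Re := (@complex.Re R).
Local Notation Im := (@complex.Im R).
Implicit Types (f g : spinor R d N) (c : R -> 'cV[C]_N) (M : 'M[C]_N) (v : 'cV[C]_N).

(** Axis lines and dilation orbits both give such curves, so one set of sum and matrix rules serves
    partial derivatives and the Euler operator alike. *)
Definition curve_derivative c v := forall k,
  is_derive (0 : R) (1 : R) (fun s => Re (c s k 0)) (Re (v k 0)) /\
  is_derive (0 : R) (1 : R) (fun s => Im (c s k 0)) (Im (v k 0)).

Lemma curve_derivative_unique c v w :
  curve_derivative c v -> curve_derivative c w -> v = w.
Proof.
move=> cv cw; apply/colP => k; apply/eqP; rewrite eq_complex.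
have [rv iv] := cv k; have [rw iw] := cw k.
by rewrite (is_derive_unique rv rw) (is_derive_unique iv iw) !eqxx.
Qed.

Lemma curve_derivativeD c c' v v' : curve_derivative c v ->
  curve_derivative c' v' -> curve_derivative (fun s => c s + c' s) (v + v').
Proof.
move=> cv cv' k; have [rv iv] := cv k; have [rv' iv'] := cv' k.
split.
  rewrite (_ : (fun s => _) = (fun s => Re (c s k 0)) + (fun s => Re (c' s k 0))).
    by rewrite mxE raddfD; exact: is_deriveD.
  by apply/funext => s; rewrite mxE raddfD.
rewrite (_ : (fun s => _) = (fun s => Im (c s k 0)) + (fun s => Im (c' s k 0))).
  by rewrite mxE raddfD; exact: is_deriveD.
by apply/funext => s; rewrite mxE raddfD.
Qed.

Lemma curve_derivative_sum (I : Type) (r : seq I) (c : I -> R -> 'cV[C]_N)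
    (v : I -> 'cV[C]_N) : (forall i, curve_derivative (c i) (v i)) ->
  curve_derivative (fun s => \sum_(i <- r) c i s) (\sum_(i <- r) v i).
Proof.
move=> cv; elim: r => [|i r IHr].
  rewrite big_nil (_ : (fun s => _) = fun=> 0); last first.
    by apply/funext => s; rewrite big_nil.
  by move=> k; rewrite mxE; split; exact: is_derive_cst.
rewrite big_cons (_ : (fun s => _) = fun s => c i s + \sum_(i <- r) c i s).
  exact: curve_derivativeD.
by apply/funext => s; rewrite big_cons.
Qed.

(** The minus sign is kept in the coefficient, so that real and imaginary parts of a product both
    have the shape treated by [is_derive_combination]. *)
Lemma Re_mulmx M v k : Re ((M *m v) k 0) =
  \sum_l (Re (M k l) * Re (v l 0) + (- Im (M k l)) * Im (v l 0)).
Proof.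
rewrite mxE raddf_sum; apply: eq_bigr => l _.
by case: (M k l) (v l 0) => [a b] [e h] /=; rewrite mulNr.
Qed.

Lemma Im_mulmx M v k : Im ((M *m v) k 0) =
  \sum_l (Im (M k l) * Re (v l 0) + Re (M k l) * Im (v l 0)).
Proof.
rewrite mxE raddf_sum; apply: eq_bigr => l _.
by case: (M k l) (v l 0) => [a b] [e h] /=; rewrite addrC.
Qed.

Lemma is_derive_combination (n : nat) (a b : 'I_n -> R) (p q : 'I_n -> R -> R)
    (dp dq : 'I_n -> R) :
  (forall l, is_derive (0 : R) (1 : R) (p l) (dp l)) ->
  (forall l, is_derive (0 : R) (1 : R) (q l) (dq l)) ->
  is_derive (0 : R) (1 : R) (fun s => \sum_l (a l * p l s + b l * q l s))
    (\sum_l (a l * dp l + b l * dq l)).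
Proof.
move=> pd qd.
have pqd l : is_derive (0 : R) (1 : R) (a l \*: p l + b l \*: q l)
    (a l * dp l + b l * dq l).
  exact: (is_deriveD (is_deriveZ _ (pd l)) (is_deriveZ _ (qd l))).
rewrite (_ : (fun s => _) = \sum_l (a l \*: p l + b l \*: q l)).
  exact: is_derive_sum.
by apply/funext => s; rewrite fct_sumE.
Qed.

Lemma curve_derivativeM M c v :
  curve_derivative c v -> curve_derivative (fun s => M *m c s) (M *m v).
Proof.
move=> cv k; split.
  rewrite Re_mulmx; under eq_fun do rewrite Re_mulmx.
  exact: (is_derive_combination _ _ (fun l => (cv l).1) (fun l => (cv l).2)).
rewrite Im_mulmx; under eq_fun do rewrite Im_mulmx.
exact: (is_derive_combination _ _ (fun l => (cv l).1) (fun l => (cv l).2)).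
Qed.

Lemma re_part_partial j f k :
  re_part (partial j f) k = 'D_(basis_vector j) (re_part f k).
Proof. by apply/funext => x; rewrite /re_part mxE. Qed.

Lemma im_part_partial j f k :
  im_part (partial j f) k = 'D_(basis_vector j) (im_part f k).
Proof. by apply/funext => x; rewrite /im_part mxE. Qed.

Lemma curve_derivative_partial j f x : C1 f ->
  curve_derivative (fun h => f (h *: basis_vector j + x)) (partial j f x).
Proof.
move=> cf k; have [cr ci] := cf k; rewrite mxE /=; split.
  apply: (iffLR (is_derive_lineP (re_part f k) x (basis_vector j) 0 _)).
  by rewrite scale0r add0r; apply: derivableP; exact: (cr j).1.
apply: (iffLR (is_derive_lineP (im_part f k) x (basis_vector j) 0 _)).
by rewrite scale0r add0r; apply: derivableP; exact: (ci j).1.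
Qed.

(** Through this lemma each rule for [curve_derivative] becomes a rule for [partial]. *)
Lemma partial_unique j f x v :
  curve_derivative (fun h => f (h *: basis_vector j + x)) v -> partial j f x = v.
Proof.
move=> fv; apply/colP => k; rewrite mxE; have [fr fi] := fv k.
have := iffRL (is_derive_lineP (re_part f k) x (basis_vector j) 0 _) fr.
have := iffRL (is_derive_lineP (im_part f k) x (basis_vector j) 0 _) fi.
rewrite scale0r add0r => -[_ ->] [_ ->].
by case: (v k 0).
Qed.

Lemma partialD j f g x : C1 f -> C1 g ->
  partial j (fun y => f y + g y) x = partial j f x + partial j g x.
Proof.
move=> cf cg; apply: partial_unique.
by apply: curve_derivativeD; exact: curve_derivative_partial.
Qed.

Lemma partialM j M f x : C1 f ->
  partial j (fun y => M *m f y) x = M *m partial j f x.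
Proof.
move=> cf; apply: partial_unique.
by apply: curve_derivativeM; exact: curve_derivative_partial.
Qed.

Lemma partial_sum j (I : Type) (r : seq I) (F : I -> spinor R d N) x :
  (forall i, C1 (F i)) ->
  partial j (fun y => \sum_(i <- r) F i y) x = \sum_(i <- r) partial j (F i) x.
Proof.
move=> cF; apply: partial_unique; apply: curve_derivative_sum => i.
exact: curve_derivative_partial.
Qed.

Lemma C1D f g : C1 f -> C1 g -> C1 (fun x => f x + g x).
Proof.
move=> cf cg k; split.
  rewrite (_ : re_part _ k = fun x => re_part f k x + re_part g k x).
    exact: continuously_derivableD (cf k).1 (cg k).1.
  by apply/funext => x; rewrite /re_part mxE raddfD.
rewrite (_ : im_part _ k = fun x => im_part f k x + im_part g k x).
  exact: continuously_derivableD (cf k).2 (cg k).2.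
by apply/funext => x; rewrite /im_part mxE raddfD.
Qed.

Lemma C1M M f : C1 f -> C1 (fun x => M *m f x).
Proof.
move=> cf k; split.
  rewrite (_ : re_part _ k = fun x => \sum_l (complex.Re (M k l) * re_part f l x +
      (- complex.Im (M k l)) * im_part f l x)).
    apply: continuously_derivable_sum => l.
    by apply: continuously_derivableD; apply: continuously_derivableZ; have [] := cf l.
  by apply/funext => x; rewrite /re_part Re_mulmx.
rewrite (_ : im_part _ k = fun x => \sum_l (complex.Im (M k l) * re_part f l x +
    complex.Re (M k l) * im_part f l x)).
  apply: continuously_derivable_sum => l.
  by apply: continuously_derivableD; apply: continuously_derivableZ; have [] := cf l.
by apply/funext => x; rewrite /im_part Im_mulmx.
Qed.

Lemma C1_sum (I : Type) (r : seq I) (F : I -> spinor R d N) :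
  (forall i, C1 (F i)) -> C1 (fun x => \sum_(i <- r) F i x).
Proof.
move=> cF k; split.
  rewrite (_ : re_part _ k = fun x => \sum_(i <- r) re_part (F i) k x).
    by apply: continuously_derivable_sum => i; have [] := cF i k.
  by apply/funext => x; rewrite /re_part summxE raddf_sum.
rewrite (_ : im_part _ k = fun x => \sum_(i <- r) im_part (F i) k x).
  by apply: continuously_derivable_sum => i; have [] := cF i k.
by apply/funext => x; rewrite /im_part summxE raddf_sum.
Qed.

Lemma C1_linear (a : C) f g : C1 f -> C1 g -> C1 (fun x => a *: f x + g x).
Proof.
(* A complex scalar acts as a scalar matrix, so the matrix rule applies. *)
move=> cf cg; under eq_fun do rewrite -mul_scalar_mx.
by apply: C1D => //; exact: C1M.
Qed.

Lemma partial_linear j (a : C) f g : C1 f -> C1 g ->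
  partial j (fun x => a *: f x + g x) = fun x => a *: partial j f x + partial j g x.
Proof.
move=> cf cg; under eq_fun do rewrite -mul_scalar_mx.
apply/funext => x; rewrite partialD//; last exact: C1M.
by rewrite partialM// mul_scalar_mx.
Qed.

Lemma C2_linear (a : C) f g : C2 f -> C2 g -> C2 (fun x => a *: f x + g x).
Proof.
move=> [cf c2f] [cg c2g]; split; first exact: C1_linear.
by move=> j; rewrite partial_linear//; exact: C1_linear.
Qed.

Lemma partialC j k f x : C2 f ->
  partial j (partial k f) x = partial k (partial j f) x.
Proof.
move=> [cf c2f]; apply/colP => l.
rewrite [LHS]mxE [RHS]mxE !re_part_partial !im_part_partial.
have cr i : continuously_derivable ('D_(basis_vector i) (re_part f l)).
  by rewrite -re_part_partial; exact: (c2f i l).1.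
have ci i : continuously_derivable ('D_(basis_vector i) (im_part f l)).
  by rewrite -im_part_partial; exact: (c2f i l).2.
exact: (f_equal2 (@Complex R) (partial_comm j k x (cf l).1 cr) (partial_comm j k x (cf l).2 ci)).
Qed.

Definition spinor_euler f : spinor R d N :=
  fun x => \sum_j (x 0 j)%:C *: partial j f x.

(** The coefficients [x_j] are real, so the Euler operator does not mix real and imaginary parts. *)
Lemma re_part_euler f k : re_part (spinor_euler f) k = euler (re_part f k).
Proof.
apply/funext => x; rewrite /re_part summxE raddf_sum; apply: eq_bigr => j _.
by rewrite !mxE /= mul0r subr0.
Qed.

Lemma im_part_euler f k : im_part (spinor_euler f) k = euler (im_part f k).
Proof.
apply/funext => x; rewrite /im_part summxE raddf_sum; apply: eq_bigr => j _.
by rewrite !mxE /= mul0r addr0.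
Qed.

Lemma curve_derivative_dilation f x : C1 f ->
  curve_derivative (fun s => f (expR s *: x)) (spinor_euler f x).
Proof.
move=> cf k; have [cr ci] := cf k; split.
  have := derive_dilation x 0 cr.
  by rewrite expR0 scale1r -re_part_euler.
have := derive_dilation x 0 ci.
by rewrite expR0 scale1r -im_part_euler.
Qed.

Lemma curve_derivative_partial_dilation j f x : C1 f -> C1 (spinor_euler f) ->
  curve_derivative (fun s => partial j f (expR s *: x))
    (partial j (spinor_euler f) x - partial j f x).
Proof.
move=> cf cef k; have [cr ci] := cf k; have [] := cef k.
rewrite re_part_euler im_part_euler => cer cei.
have partialE g y : partial j g y k 0 = 'D_(basis_vector j) (re_part g k) y +i*
    'D_(basis_vector j) (im_part g k) y by rewrite mxE.
have dE : (partial j (spinor_euler f) x - partial j f x) k 0 =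
    partial j (spinor_euler f) x k 0 - partial j f x k 0.
  by rewrite mxE; congr (_ + _); rewrite mxE.
rewrite dE; under eq_fun do rewrite partialE.
under [X in _ /\ is_derive _ _ X _]eq_fun do rewrite partialE.
rewrite !partialE re_part_euler im_part_euler; split.
  exact: derive_partial_dilation.
exact: derive_partial_dilation.
Qed.

Definition first_order (a : 'I_d -> 'M[C]_N) f : spinor R d N :=
  fun x => \sum_j a j *m partial j f x.

(** This is [[P, x . nabla] = P] for a constant-coefficient [P]. The curve [s |-> P f (e^s x)] is
    differentiated at 0 as a whole, since [P f] is C^1, and also term by term through
    [curve_derivative_partial_dilation]; the two values agree. *)
Lemma first_order_euler a f x : C1 f -> C1 (spinor_euler f) ->
  C1 (first_order a f) ->
  first_order a (spinor_euler f) x =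
  spinor_euler (first_order a f) x + first_order a f x.
Proof.
move=> cf cef cPf.
suff /(curve_derivative_unique (curve_derivative_dilation x cPf)) -> :
    curve_derivative (fun s => first_order a f (expR s *: x))
      (first_order a (spinor_euler f) x - first_order a f x) by rewrite subrK.
rewrite /first_order -sumrB; apply: curve_derivative_sum => j.
by rewrite -mulmxBr; apply: curve_derivativeM; exact: curve_derivative_partial_dilation.
Qed.

End SpinorCalculus.

(** * Squares and dilation commutators of first-order matrix operators *)

Section DiracSquare.
Context {R : realType} {d N : nat}.
Local Notation C := R[i].
Implicit Types (f g : spinor R d N) (M : 'M[C]_N).

Lemma first_order_linear (a : 'I_d -> 'M[C]_N) (c : C) f g x : C1 f -> C1 g ->
  first_order a (fun y => c *: f y + g y) x =
  c *: first_order a f x + first_order a g x.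
Proof.
move=> cf cg; rewrite /first_order scaler_sumr -big_split; apply: eq_bigr => j _.
by rewrite partial_linear// mulmxDr -scalemxAr.
Qed.

(** The double sum is added to its copy with indices exchanged. Symmetry of second derivatives lets
    the anticommutators of the [a j] appear: the diagonal gives [-2] times each second derivative
    and the other terms vanish. *)
Lemma first_order_square (a : 'I_d -> 'M[C]_N) f x :
  (forall j k, a j *m a k + a k *m a j = - (2 * (j == k)%:R)%:M) -> C2 f ->
  first_order a (first_order a f) x = - \sum_j partial j (partial j f) x.
Proof.
move=> aa c2f; have [cf cpf] := c2f.
pose S := \sum_j \sum_k (a j *m a k) *m partial j (partial k f) x.
have -> : first_order a (first_order a f) x = S.
  apply: eq_bigr => j _; rewrite partial_sum => [|k]; last exact: C1M.
  by rewrite mulmx_sumr; apply: eq_bigr => k _; rewrite partialM// mulmxA.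
have S2 : S + S = 2 *: - \sum_j partial j (partial j f) x.
  rewrite {2}/S exchange_big -big_split scalerN scaler_sumr -sumrN /=.
  apply: eq_bigr => j _; rewrite -big_split (bigD1 j)//= [X in _ + X]big1.
    by rewrite addr0 -mulmxDl aa eqxx mulr1 mulNmx mul_scalar_mx.
  move=> k kj; rewrite (partialC k j)// -mulmxDl aa eq_sym (negbTE kj) mulr0.
  by rewrite raddf0 oppr0 mul0mx.
have two0 : (2 : C) != 0 by rewrite pnatr_eq0.
by apply: (scalerI two0); rewrite -S2 scaler_nat mulr2n.
Qed.

Lemma first_order_anticomm (a : 'I_d -> 'M[C]_N) (b : 'M[C]_N) f x :
  (forall j, a j *m b + b *m a j = 0) -> C1 f ->
  first_order a (fun y => b *m f y) x = - (b *m first_order a f x).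
Proof.
move=> ab cf; rewrite /first_order mulmx_sumr -sumrN; apply: eq_bigr => j _.
rewrite partialM// !mulmxA -mulNmx; congr (_ *m _).
by apply/eqP; rewrite -addr_eq0 ab.
Qed.

(** The cross terms cancel because [b] anticommutes with every [a j], which leaves the squares of
    the two parts. *)
Lemma first_order_mass_square (a : 'I_d -> 'M[C]_N) (b : 'M[C]_N) (q : C) f x :
  (forall j k, a j *m a k + a k *m a j = - (2 * (j == k)%:R)%:M) ->
  (forall j, a j *m b + b *m a j = 0) -> b *m b = q%:M -> C2 f ->
  let D g y := first_order a g y + b *m g y in
  D (D f) x = q *: f x - \sum_j partial j (partial j f) x.
Proof.
move=> aa ab bb c2f D; have [cf cpf] := c2f.
have cP : C1 (first_order a f) by apply: C1_sum => j; exact: C1M.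
have -> : D (D f) x = first_order a (first_order a f) x +
    first_order a (fun y => b *m f y) x + b *m D f x.
  congr (_ + _); under [D f]eq_fun do rewrite -[X in X + _]scale1r.
  by rewrite first_order_linear// ?scale1r//; exact: C1M.
rewrite first_order_square// first_order_anticomm// mulmxDr mulmxA bb.
by rewrite mul_scalar_mx addrA subrK addrC.
Qed.

Lemma spinor_eulerM M f x : C1 f ->
  spinor_euler (fun y => M *m f y) x = M *m spinor_euler f x.
Proof.
move=> cf; rewrite mulmx_sumr; apply: eq_bigr => j _.
by rewrite partialM// -scalemxAr.
Qed.

Lemma spinor_eulerD f g x : C1 f -> C1 g ->
  spinor_euler (fun y => f y + g y) x = spinor_euler f x + spinor_euler g x.
Proof.
move=> cf cg; rewrite /spinor_euler -big_split; apply: eq_bigr => j _.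
by rewrite partialD// scalerDr.
Qed.

Lemma C1_first_order (a : 'I_d -> 'M[C]_N) f : C2 f -> C1 (first_order a f).
Proof. by move=> [_ cpf]; apply: C1_sum => j; exact: C1M. Qed.

Lemma first_orderD (a : 'I_d -> 'M[C]_N) f g x : C1 f -> C1 g ->
  first_order a (fun y => f y + g y) x = first_order a f x + first_order a g x.
Proof.
move=> cf cg; rewrite -[first_order a f x]scale1r -first_order_linear//.
by under [in RHS]eq_fun do rewrite scale1r.
Qed.

(** The constants [q] and [b] commute with everything that [K] and [D] contribute here, except that
    the first-order part meets the Euler operator; that pair leaves one copy of
    [first_order a f]. *)
Lemma mass_dilation_commute (a : 'I_d -> 'M[C]_N) (b : 'M[C]_N) (q : C) f x :
  let D g y := first_order a g y + b *m g y in
  let K g y := q *: g y + spinor_euler g y in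
  C1 f -> C1 (K f) -> C1 (D f) -> D (K f) x = K (D f) x + first_order a f x.
Proof.
move=> D K cf cKf cDf.
(* As [f] is merely C^1, regularity of the Euler part is recovered from [K f] by subtracting
   [q *: f]; likewise below for the first-order part, from [D f]. *)
have cE : C1 (spinor_euler f).
  rewrite (_ : spinor_euler f = fun y => (- q) *: f y + K f y).
    exact: C1_linear.
  by apply/funext => y; rewrite /K addrA scaleNr addNr add0r.
have cP : C1 (first_order a f).
  rewrite (_ : first_order a f = fun y => (- 1) *: (b *m f y) + D f y).
    by apply: C1_linear => //; exact: C1M.
  by apply/funext => y; rewrite /D scaleN1r addrCA addNr addr0.
rewrite /D /K first_order_linear// first_order_euler//.
rewrite (spinor_eulerD _ cP (C1M b cf)) (spinor_eulerM b x cf).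
rewrite mulmxDr scalerDr -scalemxAr.
move: (q *: _) (spinor_euler _ x) (first_order _ _ _) (q *: _) (b *m _) => A B D' E F.
by rewrite -!addrA (addrCA D') (addrCA B) (addrC D').
Qed.

(* [f] has only two derivatives, so [K f] need not be [C2] and the square of
   [D] cannot be computed on it directly; [mass_dilation_commute] is applied
   twice instead, to [f] and to [D f]. *)
Lemma first_order_mass_dilation (a : 'I_d -> 'M[C]_N) (b : 'M[C]_N) (q : C) f x :
  (forall j k, a j *m a k + a k *m a j = - (2 * (j == k)%:R)%:M) ->
  (forall j, a j *m b + b *m a j = 0) ->
  let D g y := first_order a g y + b *m g y in
  let K g y := q *: g y + spinor_euler g y in
  C2 f -> C1 (K f) -> C1 (D f) -> C1 (K (D f)) -> C1 (D (D f)) ->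
  D (D (K f)) x - K (D (D f)) x = 2 *: - \sum_j partial j (partial j f) x.
Proof.
move=> aa ab D K c2f cKf cDf cKDf cDDf; have [cf _] := c2f.
have cP := C1_first_order a c2f.
have DD g h y : C1 g -> C1 h -> D (fun y => g y + h y) y = D g y + D h y.
  by move=> cg ch; rewrite /D first_orderD// mulmxDr addrACA.
have E1 y : D (K f) y = K (D f) y + first_order a f y.
  exact: (@mass_dilation_commute a b q f y cf cKf cDf).
have E2 : D (K (D f)) x = K (D (D f)) x + first_order a (D f) x.
  exact: (@mass_dilation_commute a b q (D f) x cDf cKDf cDDf).
(* With [P] the first-order part, [P D f + D P f] remains. Its mass terms cancel by anticommutation,
   leaving twice [P P f]. *)
rewrite (funext E1) (DD _ _ _ cKDf cP) E2.
have -> : first_order a (D f) x =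
    first_order a (first_order a f) x - b *m first_order a f x.
  by rewrite first_orderD ?first_order_anticomm//; exact: C1M.
rewrite -(first_order_square x aa c2f).
have -> : D (first_order a f) x =
    first_order a (first_order a f) x + b *m first_order a f x by [].
move: (K _ x) (first_order a _ x) (b *m _) => A B E.
by rewrite scaler_nat mulr2n addrAC (addrAC A) subrr add0r addrACA addNr addr0.
Qed.
End DiracSquare.

(** * Linear operators with domains, and commutator algebra on them *)

Section LinearOperators.
Context {R : realType} {d N : nat}.
Implicit Types (A B V : operator R d N) (f g : spinor R d N) (c : R[i]).

(** The second clause equates functions, not values at a point, because results are fed to further
    operators and tested for membership in their domains. *)
Definition linear_operator A := forall c f g, dom A f -> dom A g ->
  dom A (fun x => c *: f x + g x) /\
  A (fun x => c *: f x + g x) = fun x => c *: A f x + A g x.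

Lemma linear_operator_scale A c f : linear_operator A -> dom A f ->
  dom A (fun x => c *: f x) /\ A (fun x => c *: f x) = fun x => c *: A f x.
Proof.
(* [c *: f] is written as [(c - 1) *: f + f], a combination of two members of the domain. *)
move=> lA fA; have := lA (c - 1) f f fA fA.
have E (h : spinor R d N) : (fun x => (c - 1) *: h x + h x) = fun x => c *: h x.
  by apply/funext => x; rewrite scalerBl scale1r subrK.
by rewrite !E.
Qed.

Lemma linear_operator_sub A f g : linear_operator A -> dom A f -> dom A g ->
  dom A (fun x => f x - g x) /\ A (fun x => f x - g x) = fun x => A f x - A g x.
Proof.
move=> lA fA gA; have := lA (-1) g f gA fA.
have E (h k : spinor R d N) : (fun x => -1 *: h x + k x) = fun x => k x - h x.
  by apply/funext => x; rewrite scaleN1r addrC.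
by rewrite !E.
Qed.

Lemma linear_op_add A B :
  linear_operator A -> linear_operator B -> linear_operator (op_add A B).
Proof.
move=> lA lB c f g [fA fB] [gA gB].
have [dA eA] := lA c f g fA gA; have [dB eB] := lB c f g fB gB.
split=> //=; rewrite eA eB; apply/funext => x.
by rewrite scalerDr addrACA.
Qed.

Lemma linear_op_sub A B :
  linear_operator A -> linear_operator B -> linear_operator (op_sub A B).
Proof.
move=> lA lB c f g [fA fB] [gA gB].
have [dA eA] := lA c f g fA gA; have [dB eB] := lB c f g fB gB.
split=> //=; rewrite eA eB; apply/funext => x.
by rewrite scalerBr opprD addrACA.
Qed.

Lemma linear_op_scale c A : linear_operator A -> linear_operator (op_scale c A).
Proof.
move=> lA e f g fA gA; have [dA eA] := lA e f g fA gA.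
split=> //=; rewrite eA; apply/funext => x.
by rewrite scalerDr !scalerA mulrC.
Qed.

Lemma linear_op_mul A B :
  linear_operator A -> linear_operator B -> linear_operator (op_mul A B).
Proof.
move=> lA lB c f g [fB fA] [gB gA].
have [dB eB] := lB c f g fB gB; have [dA eA] := lA c (B f) (B g) fA gA.
by split=> /=; rewrite eB.
Qed.

Lemma linear_commutator A B :
  linear_operator A -> linear_operator B -> linear_operator (commutator A B).
Proof. by move=> lA lB; apply: linear_op_sub; apply: linear_op_mul. Qed.

Lemma linear_anticommutator A B :
  linear_operator A -> linear_operator B -> linear_operator (anticommutator A B).
Proof. by move=> lA lB; apply: linear_op_add; apply: linear_op_mul. Qed.

Lemma linear_op_scalar (phi : 'rV[R]_d -> R) :
  linear_operator (op_scalar phi : operator R d N).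
Proof.
move=> c f g _ _; split=> //=; apply/funext => x.
by rewrite scalerDr !scalerA mulrC.
Qed.

Lemma linear_free_schrodinger : linear_operator (@free_schrodinger R d N).
Proof.
move=> c f g cf cg; split; first exact: (C2_linear c cf cg).
have E j x : partial j (partial j (fun y => c *: f y + g y)) x =
    c *: partial j (partial j f) x + partial j (partial j g) x.
  by rewrite (partial_linear j c cf.1 cg.1) (partial_linear j c (cf.2 j) (cg.2 j)).
apply/funext => x.
have -> : free_schrodinger (fun y => c *: f y + g y) x =
    - (c *: \sum_j partial j (partial j f) x + \sum_j partial j (partial j g) x).
  congr (- _); rewrite scaler_sumr -big_split.
  by apply: eq_bigr => j _; exact: E.
by rewrite opprD -scalerN.
Qed.

(** Moving [-i] into the matrices presents [free_dirac] as [first_order] plus a constant matrix. *)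
Definition dirac_coef (alpha : 'I_d -> 'M[R[i]]_N) (j : 'I_d) : 'M[R[i]]_N :=
  - 'i%C *: alpha j.

Lemma free_diracE alpha beta m f x : free_dirac alpha beta m f x =
  first_order (dirac_coef alpha) f x + (m%:C%C *: beta) *m f x.
Proof.
rewrite /= scaler_sumr -scalemxAl; congr (_ + _).
by apply: eq_bigr => j _; rewrite -scalemxAl.
Qed.

Lemma linear_free_dirac alpha beta m : linear_operator (@free_dirac R d N alpha beta m).
Proof.
move=> c f g cf cg; split; first exact: (C1_linear c cf cg).
apply/funext => x; rewrite !free_diracE.
by rewrite first_order_linear// mulmxDr -scalemxAr scalerDr addrACA.
Qed.

Lemma dilationE f x :
  @dilation R d N f x = (d%:R / 2) *: f x + spinor_euler f x.
Proof. by []. Qed.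

Lemma linear_dilation : linear_operator (@dilation R d N).
Proof.
move=> c f g cf cg; split; first exact: (C1_linear c cf cg).
apply/funext => x; rewrite !dilationE.
have -> : spinor_euler (fun y => c *: f y + g y) x =
    c *: spinor_euler f x + spinor_euler g x.
  rewrite /spinor_euler scaler_sumr -big_split; apply: eq_bigr => j _.
  by rewrite partial_linear// scalerDr !scalerA mulrC.
by rewrite !scalerDr !scalerA [c * _]mulrC addrACA.
Qed.

Lemma linear_dilation_weighted phi : linear_operator (@dilation_weighted R d N phi).
Proof.
apply: linear_op_scale; apply: linear_commutator; last exact: linear_op_scalar.
exact: linear_free_schrodinger.
Qed.

(* [B f = (B + V) f - V f] puts [B f] in the domain of [L], which the
   hypotheses do not state. *)
Lemma commutator_add_potential A V L f : linear_operator L ->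
  dom (commutator (op_add A V) L) f -> dom (commutator V L) f ->
  dom (commutator A L) f /\
  forall x, commutator (op_add A V) L f x = commutator A L f x + commutator V L f x.
Proof.
move=> lL [[Lf [ALf VLf]] [[Af Vf] LAVf]] [_ [_ LVf]].
have [LAf eL] := linear_operator_sub lL LAVf LVf.
have E : (fun x => op_add A V f x - V f x) = A f.
  by apply/funext => x /=; rewrite addrK.
rewrite E in LAf eL; split; first by [].
move=> x /=; rewrite eL /= opprB [RHS]addrACA; congr (_ + _).
by rewrite addrAC subrr add0r.
Qed.

(** This is [[A, {A, K}] = [A^2, K]], where the [A K A] terms cancel. Since [A K f] is the
    difference of [{A, K} f] and [K A f], both in the domain of [A], linearity allows [A] to be
    applied to it. *)
Lemma commutator_anticommutator A K f : linear_operator A ->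
  dom (commutator A (anticommutator A K)) f ->
  [/\ dom K f, dom A (K f), dom K (A f), dom A (K (A f)) & dom K (A (A f))] /\
  forall x, commutator A (anticommutator A K) f x = A (A (K f)) x - K (A (A f)) x.
Proof.
move=> lA [[[[Kf AKf] [Af KAf]] ALf] [_ [[_ AKAf] [AAf KAAf]]]].
have [AAKf eA] := linear_operator_sub lA ALf AKAf.
have E : (fun x => anticommutator A K f x - K (A f) x) = A (K f).
  by apply/funext => x /=; rewrite addrK.
rewrite E in AAKf eA; split; first by split.
by move=> x; rewrite eA /= opprD addrA.
Qed.
End LinearOperators.

(** * The Clifford relations applied to the free Dirac operator *)

Section DiracOperator.
Context {R : realType} {d N : nat}.
Context (alpha : 'I_d -> 'M[R[i]]_N) (beta : 'M[R[i]]_N) (m : R)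
  (alpha_alpha : forall j k,
    alpha j *m alpha k + alpha k *m alpha j = (2 * (j == k)%:R)%:M)
  (alpha_beta : forall j, alpha j *m beta + beta *m alpha j = 0)
  (beta_beta : beta *m beta = 1%:M).
Let HD := free_dirac alpha beta m.
Let H0 := @free_schrodinger R d N.

(** The factor [(-i)^2 = -1] turns the Clifford relation into the negative one that
    [first_order_square] expects. *)
Lemma dirac_coef_anticomm j k : dirac_coef alpha j *m dirac_coef alpha k +
  dirac_coef alpha k *m dirac_coef alpha j = - (2 * (j == k)%:R)%:M.
Proof.
rewrite -!scalemxAl -!scalemxAr !scalerA -scalerDr alpha_alpha mulrNN.
by rewrite -expr2 sqr_i scaleN1r.
Qed.

Lemma dirac_coef_mass_anticomm j : dirac_coef alpha j *m (m%:C%C *: beta) +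
  (m%:C%C *: beta) *m dirac_coef alpha j = 0.
Proof.
by rewrite -!scalemxAl -!scalemxAr !scalerA mulrC -scalerDr alpha_beta scaler0.
Qed.

(** An equality of actions as functions, so that nested applications such as [HD (HD f)] can be
    rewritten. *)
Lemma free_dirac_actE : HD =
  (fun g y => first_order (dirac_coef alpha) g y + (m%:C%C *: beta) *m g y)
  :> (spinor R d N -> spinor R d N).
Proof. by apply/funext => g; apply/funext => y; exact: free_diracE. Qed.

Lemma free_dirac_square f : C2 f ->
  HD (HD f) = fun x => (m%:C%C ^+ 2) *: f x + H0 f x.
Proof.
move=> c2f.
rewrite free_dirac_actE; apply/funext => x.
apply: (first_order_mass_square x dirac_coef_anticomm dirac_coef_mass_anticomm _ c2f).
by rewrite -scalemxAl -scalemxAr scalerA beta_beta scalemx1 expr2.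
Qed.

Lemma free_dirac_dilation f x : C2 f -> C1 (dilation f) -> C1 (HD f) ->
  C1 (dilation (HD f)) -> C1 (HD (HD f)) ->
  HD (HD (dilation f)) x - dilation (HD (HD f)) x = 2 *: H0 f x.
Proof.
move=> c2f.
rewrite free_dirac_actE.
exact: (first_order_mass_dilation x dirac_coef_anticomm dirac_coef_mass_anticomm c2f).
Qed.
End DiracOperator.

(** * The commutators of [H] with [L] and with [Lphi] *)

Theorem proposition1p1 (R : realType) (d : nat) (hd : (1 <= d)%N) (N : nat)
    (hN : N = (2 ^ ((d + 1) %/ 2))%N)
    (alpha : 'I_d -> 'M[R[i]]_N) (beta : 'M[R[i]]_N)
    (alpha_herm : forall j, alpha j \is hermsymmx)
    (beta_herm : beta \is hermsymmx)
    (alpha_alpha : forall j k,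
      alpha j *m alpha k + alpha k *m alpha j = (2 * (j == k)%:R)%:M)
    (alpha_beta : forall j, alpha j *m beta + beta *m alpha j = 0)
    (beta_beta : beta *m beta = 1%:M)
    (m : R) (hm : 0 <= m)
    (V : 'rV[R]_d -> 'M[R[i]]_N) (phi : 'rV[R]_d -> R) :
  let H0 := @free_schrodinger R d N in
  let HD := free_dirac alpha beta m in
  let H := op_add HD (op_matrix V) in
  let L := anticommutator HD dilation in
  let Lphi := anticommutator HD (dilation_weighted phi) in
  op_identity (commutator H L)
    (op_add (op_scale 2 H0) (commutator (op_matrix V) L))
  /\
  op_identity (commutator H Lphi)
    (op_add
      (op_scale (- 4^-1) (commutator H0 (commutator H0 (op_scalar phi))))
      (commutator (op_matrix V) Lphi)).
Proof.
move=> H0 HD H L Lphi.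
have lHD : linear_operator HD by exact: linear_free_dirac.
split.
  have lL : linear_operator L.
    by apply: linear_anticommutator => //; exact: linear_dilation.
  (* The term [2 H_0] on the right supplies that [f] is C^2. *)
  move=> f fHL [c2f fVL] x.
  have [fDL E1] := @commutator_add_potential R d N HD (op_matrix V) L f lL fHL fVL.
  have [[Kf DKf KDf DKDf KDDf] E2] :=
    @commutator_anticommutator R d N HD dilation f lHD fDL.
  have E3 := free_dirac_dilation alpha_alpha alpha_beta x c2f DKf KDf DKDf KDDf.
  have E4 : commutator HD L f x = 2 *: H0 f x := etrans (E2 x) E3.
  exact: (etrans (E1 x) (congr1 (fun z => z + commutator (op_matrix V) L f x) E4)).
have lK : linear_operator (@dilation_weighted R d N phi).
  exact: linear_dilation_weighted.
have lL : linear_operator Lphi by exact: linear_anticommutator.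
(* With [W = [H_0, phi]], the domain of [[H_0, W]] provides that [W f] and [f] are C^2 and that
   [H_0 f] lies in the domain of [W]. *)
move=> f fHL [[[_ c2W] [c2f WH0f]] fVL] x.
have [fDL E1] := @commutator_add_potential R d N HD (op_matrix V) Lphi f lL fHL fVL.
have [[Kf DKf KDf DKDf KDDf] E2] :=
  @commutator_anticommutator R d N HD (dilation_weighted phi) f lHD fDL.
pose W := commutator H0 (op_scalar phi).
(* Here [K f = - 1/4 W f], so it is C^2 and the square of [H_D] can be computed on it. *)
have [c2Kf E3] := @linear_operator_scale R d N H0 (- 4^-1) (W f)
  (@linear_free_schrodinger R d N) c2W.
have [_ E4] := lK ((m%:C)%C ^+ 2) f (H0 f) Kf WH0f.
have E5 : op_scale (- 4^-1) (commutator H0 W) f x =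
    H0 (dilation_weighted phi f) x - dilation_weighted phi (H0 f) x.
  rewrite [LHS]scalerBr; congr (_ - _).
  exact: (esym (congr1 (fun h => h x) E3)).
have E6 : commutator HD Lphi f x = op_scale (- 4^-1) (commutator H0 W) f x.
  apply: (etrans (E2 x)).
  (* Both squares become [m^2 + H_0]; by linearity of [K] the two terms [m^2 K f] cancel. *)
  rewrite (free_dirac_square m alpha_alpha alpha_beta beta_beta c2Kf).
  rewrite (free_dirac_square m alpha_alpha alpha_beta beta_beta c2f).
  rewrite E4 E5.
  by rewrite opprD addrACA subrr add0r.
exact: (etrans (E1 x) (congr1 (fun z => z + commutator (op_matrix V) Lphi f x) E6)).
Qed.
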